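(* Fix any sequences $b_n,\gamma_n>0$ such that $b_n/\gamma_n\to 0$. Then there exists a sequence $\epsilon_n\to 0$ such that \[\lim_{n \to \infty}\ \sup_{\substack{\mathcal{A}, P\text{ s.t. }\\ \beta_{1,n+1}^{*,\mathrm{in}}(\mathcal{A},P) \le b_{n}}}\mathbb{P}\left\{\alpha_{P}^{\gamma_n\text{-CP}}(\mathcal{D}_n)\geq \alpha + \epsilon_n\right\} =0,\] where the supremum is over symmetric regression algorithms $\mathcal{A}$ and distributions $P$ on $\mathcal{X}\times\mathbb{R}$ satisfying the indicated constraint, and $\mathcal{D}_n=\{(X_i,Y_i)\}_{i\in[n]}$ is drawn i.i.d. from $P$.
   Context: Write $[n]=\{1,\dots,n\}$. Let $\mathcal{X}$ be a measurable space. A regression algorithm is a map $\mathcal{A}:\bigcup_{n\geq 0}(\mathcal{X}\times\mathbb{R})^n\to\{\text{measurable functions }\mathcal{X}\to\mathbb{R}\}$. It is symmetric if for each $n\ge1$, each data set and each permutation $\pi$ of $[n]$, $\mathcal{A}((X_1,Y_1),\dots,(X_n,Y_n))=\mathcal{A}((X_{\pi(1)},Y_{\pi(1)}),\dots,(X_{\pi(n)},Y_{\pi(n)}))$. All quantities whose probabilities or expectations are taken are understood to be measurable. A target level $\alpha\in(0,1)$ is fixed. Quantile: for real $v_1,\dots,v_n$ and $\tau\in\mathbb{R}$, $\mathrm{Quantile}(\{v_i\}_{i\in[n]};\tau)=\inf\{t\in\mathbb{R}: \#\{i\in[n]: v_i\le t\}\ge \tau n\}$, equal to $+\infty$ if $\tau>1$.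 Inflated full conformal prediction: given $\mathcal{D}_n=\{(X_i,Y_i)\}_{i\in[n]}$, a test feature $X_{n+1}$ and $y\in\mathbb{R}$, let $\widehat\mu^y=\mathcal{A}((X_1,Y_1),\dots,(X_n,Y_n),(X_{n+1},y))$. For $\gamma\ge0$, the $\gamma$-inflated full conformal prediction set is \[\widehat{C}^{\gamma\text{-CP}}_n(X_{n+1})=\Big\{y\in\mathbb{R}: |y-\widehat\mu^y(X_{n+1})|\le \mathrm{Quantile}\big(\{|Y_i-\widehat\mu^y(X_i)|\}_{i\in[n]};(1-\alpha)(1+1/n)\big)+\gamma\Big\}.\] Its training-conditional miscoverage rate is $\alpha_P^{\gamma\text{-CP}}(\mathcal{D}_n)=\mathbb{P}\{Y_{n+1}\notin\widehat{C}^{\gamma\text{-CP}}_n(X_{n+1})\mid\mathcal{D}_n\}$, where $(X_{n+1},Y_{n+1})\sim P$ is independent of $\mathcal{D}_n$. In-sample $1$-stability: for $n\ge1$, $\beta^{\mathrm{in}}_{1,n}(\mathcal{A},P)=\mathbb{E}[|\widehat\mu_n(X_1)-\widehat\mu_{n+1}(X_1)|]$, where $\widehat\mu_k=\mathcal{A}((X_1,Y_1),\dots,(X_k,Y_k))$ and $(X_1,Y_1),\dots,(X_{n+1},Y_{n+1})$ are i.i.d. from $P$. Define $\beta^{*,\mathrm{in}}_{1,n}(\mathcal{A},P)=\sup_{n'\ge n}\beta^{\mathrm{in}}_{1,n'}(\mathcal{A},P)$. *)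

(* Defs.v *)
From HB Require Import structures.
From mathcomp Require Import all_boot all_order all_algebra perm.
From mathcomp Require Import all_classical all_reals all_analysis.

Set Implicit Arguments.
Unset Strict Implicit.
Unset Printing Implicit Defensive.

Import Order.TTheory GRing.Theory Num.Theory.
Import numFieldNormedType.Exports.

Local Open Scope classical_set_scope.
Local Open Scope ring_scope.

Section iid_law.
Context d (T : measurableType d) (R : realType).

Definition cons_pair n (z : T * n.-tuple T) : n.+1.-tuple T :=
  [tuple of z.1 :: z.2].

Lemma measurable_cons_pair n : measurable_fun setT (@cons_pair n).
Proof. exact: (measurable_cons (f := fst) (g := snd)). Qed.

HB.instance Definition _ n :=
  isMeasurableFun.Build _ _ _ _ (@cons_pair n) (@measurable_cons_pair n).

(* The n-fold product of P, i.e. the law of n i.i.d. draws from P; see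
   [iid_law_box]. *)
Fixpoint iid_law (P : probability T R) (n : nat) : probability (n.-tuple T) R :=
  match n with
  | 0 => \d_ ([tuple] : 0.-tuple T)
  | n'.+1 => distribution (P \x iid_law P n')%E (@cons_pair n')
  end.

Lemma iid_law_box (P : probability T R) n (B : 'I_n -> set T) :
  (forall i, measurable (B i)) ->
  iid_law P n [set t | forall i, B i (tnth t i)] = (\prod_(i < n) P (B i))%E.
Proof.
elim: n B => [|n IH] B mB /=.
  by rewrite big_ord0 diracE mem_set// => -[].
rewrite big_ord_recl -(IH (fun i => B (lift ord0 i)))//.
rewrite -product_measure1E//; last first.
  rewrite (_ : [set _ | _] =
    \bigcap_(i in [set: 'I_n]) ((@tnth n T)^~ i @^-1` B (lift ord0 i))).
    apply: fin_bigcap_measurable => // i _.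
    by rewrite -[X in measurable X]setTI; exact: measurable_tnth.
  by apply/seteqP; split => t /= Ht i; [move=> _|]; exact: Ht.
congr (product_measure1 _ _ _); apply/seteqP; split=> -[x t] /=.
  move=> H; split=> [|i]; first exact: (H ord0).
  by have := H (lift ord0 i); rewrite tnthS.
move=> [/= Hx Ht] i; case: (unliftP ord0 i) => [j ->|-> //].
by rewrite tnthS; exact: Ht.
Qed.

End iid_law.

Section conformal.
Context d (X : measurableType d) (R : realType).

Definition algorithm := seq (X * R) -> {mfun X >-> R}.

Definition symmetric_algorithm (A : algorithm) : Prop :=
  forall n (D : n.-tuple (X * R)) (s : 'S_n),
    A D = A [tuple tnth D (s i) | i < n] :> (X -> R).

(* The infimum is taken in the extended reals, so the value is +oo when
   tau > 1 and v is nonempty. *)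
Definition quantile (v : seq R) (tau : R) : \bar R :=
  ereal_inf [set t%:E | t in
    [set t : R | tau * (size v)%:R <= (count (fun x => x <= t) v)%:R]].

Definition cp_set (A : algorithm) (alpha gamma : R) n (D : n.-tuple (X * R))
    (x : X) : set R :=
  [set y | let mu := A (rcons D (x, y)) in
    let scores := [seq `|z.2 - mu z.1| | z <- D] in
    (`|y - mu x|%:E <=
      quantile scores ((1 - alpha) * (1 + n%:R^-1))%R + gamma%:E)%E].

Definition miscoverage (A : algorithm) (P : probability (X * R)%type R)
    (alpha gamma : R) n (D : n.-tuple (X * R)) : \bar R :=
  P [set z | ~ cp_set A alpha gamma D z.1 z.2].

Definition in_sample_change (A : algorithm) n (D : n.+1.-tuple (X * R)) : R :=
  let X1 := (thead D).1 in `|A (take n D) X1 - A D X1|.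

Definition beta_in (A : algorithm) (P : probability (X * R)%type R) n : \bar R :=
  (\int[iid_law P n.+1]_D (in_sample_change A D)%:E)%E.

Definition beta_in_star (A : algorithm) (P : probability (X * R)%type R) n :
    \bar R :=
  ereal_sup [set beta_in A P n' | n' in [set n' | (n <= n')%N]].

(* Measurability of the quantities whose expectation or probability is taken:
   the integrand of [beta_in], and the event that the test point is not
   covered, jointly in the training sample and the test point (hence
   [miscoverage] is measurable in the training sample). *)
Definition stability_measurable (A : algorithm) : Prop :=
  forall n, (0 < n)%N -> measurable_fun setT (@in_sample_change A n).

Definition cp_measurable (A : algorithm) (alpha gamma : R) n : Prop :=
  measurable [set w : n.-tuple (X * R) * (X * R) |
    ~ cp_set A alpha gamma w.1 w.2.1 w.2.2].

End conformal.

(* Main.v *)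
Require Import Defs.
From HB Require Import structures.
From mathcomp Require Import all_boot all_order all_algebra perm.
From mathcomp Require Import all_classical all_reals all_analysis.
From mathcomp Require Import measurable_realfun.
From mathcomp Require Import ring lra.

Set Implicit Arguments.
Unset Strict Implicit.
Unset Printing Implicit Defensive.

Import Order.TTheory GRing.Theory Num.Theory.
Import numFieldNormedType.Exports.

Local Open Scope classical_set_scope.
Local Open Scope ring_scope.

(** Fix [eta > 0]. By Markov's inequality for the [k]-th power, the probability
that the miscoverage of a training sample of size [n] is at least
[alpha + 3 * eta] is at most [(alpha + 3 * eta) ^- k] times its [k]-th moment,
and that moment is the probability that [k] further independent test points are
all missed ([miscoverage_markov]).

To bound the latter, compare the model refitted with one test point to the model
[mu] fitted on all [n + k] points. It is reached by adding the remaining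
[k - 1] test points one by one, and each addition moves the prediction at a
point already in the sample by at most [b] on average ([stability_add]). If the
inflation [gamma] dominates [k * b], then, outside an event whose probability is
a multiple of [b / gamma], almost no prediction moves by more than [gamma / 2],
so that a missed test point has a residual under [mu] exceeding those of a
fraction [1 - alpha - eta] of the training points ([miscovered_high_rank]). The
residuals under the single symmetric fit [mu] are exchangeable, and at most
[(alpha + eta) * n + k] of the [n + k] points can rank that high; hence all [k]
test points do so with probability at most [(alpha + eta + k / n) ^ k]
([all_missed_bound]).

For [k <= eta * n] the outcome is
[((alpha + 2 * eta) / (alpha + 3 * eta)) ^ k + C * (b / gamma)], where [C] only
depends on [eta], [alpha] and [k] ([miscoverage_tail]). A large [k] makes the
first term small, then a large [n] the second one. This gives every fixed
[eta], and a diagonal choice turns it into a vanishing sequence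
([diagonal_rate]).

Predictions need not be measurable functions of the training sample, only the
in-sample changes and the miscoverage events are. For this reason the
exchangeability argument is an inequality between finite sums over
rearrangements of one realisation, which is integrated at the very end. *)

(** * Nonnegative functions with a bounded mean *)

Section mean_le.
Context d (T : measurableType d) (R : realType) (Q : {measure set T -> \bar R}).

(** Majorants are passed around together with their mean because their explicit
form, a sum of in-sample changes of subsamples, is never needed. *)
Definition mean_le (H : T -> R) (c : R) :=
  [/\ measurable_fun setT H, forall x, 0 <= H x
    & (\int[Q]_x (H x)%:E <= c%:E)%E].

Lemma mean_le0 : mean_le (fun=> 0) 0.
Proof. by split => //; rewrite integral0. Qed.

Lemma mean_leW H c c' : c <= c' -> mean_le H c -> mean_le H c'.
Proof.
by move=> cc' [mH H0 Hc]; split => //; rewrite (le_trans Hc)// lee_fin.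
Qed.

Lemma mean_leD H K a c : mean_le H a -> mean_le K c ->
  mean_le (fun x => H x + K x) (a + c).
Proof.
move=> [mH H0 Ha] [mK K0 Kc]; split.
- exact: measurable_funD.
- by move=> x; rewrite addr_ge0.
- under eq_integral do rewrite EFinD.
  rewrite ge0_integralD//; last 4 first.
  + by move=> x _; rewrite lee_fin.
  + exact/measurable_EFinP.
  + by move=> x _; rewrite lee_fin.
  + exact/measurable_EFinP.
  by rewrite EFinD leeD.
Qed.

Lemma mean_leZ H r c : 0 <= r -> mean_le H c ->
  mean_le (fun x => r * H x) (r * c).
Proof.
move=> r0 [mH H0 Hc]; split.
- exact: measurable_funM.
- by move=> x; rewrite mulr_ge0.
- under eq_integral do rewrite EFinM.
  rewrite ge0_integralZl//; last 2 first.
  + exact/measurable_EFinP.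
  + by move=> x _; rewrite lee_fin.
  by rewrite EFinM lee_wpmul2l// lee_fin.
Qed.

Lemma mean_le_sum (I : finType) (p : pred I) (H : I -> T -> R) c :
  (forall i, p i -> mean_le (H i) c) ->
  mean_le (fun x => \sum_(i | p i) H i x) (#|p|%:R * c).
Proof.
move=> Hc; rewrite mulr_natl -sumr_const.
have -> : (fun x => \sum_(i | p i) H i x) =
    \big[(fun f g => fun x => f x + g x)/(fun=> 0)]_(i | p i) H i.
  by apply/funext => x; elim/big_rec2: _ => // i f y _ ->.
elim/big_rec2: _ => [|i f y pi]; first exact: mean_le0.
by move/(mean_leD (Hc i pi)).
Qed.

End mean_le.

(** * Laws of i.i.d. samples *)

Section iid_sample.
Context d (T : measurableType d) (R : realType).

Definition box n (B : 'I_n -> set T) : set (n.-tuple T) :=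
  [set t | forall i, B i (tnth t i)].

Lemma boxE n (B : 'I_n -> set T) :
  box B = \bigcap_(i in [set: 'I_n]) ((@tnth n T)^~ i @^-1` B i).
Proof. by apply/seteqP; split => t /= Bt i; [move=> _|]; exact: Bt. Qed.

Lemma measurable_box n (B : 'I_n -> set T) :
  (forall i, measurable (B i)) -> measurable (box B).
Proof.
move=> mB; rewrite boxE; apply: fin_bigcap_measurable => // i _.
by rewrite -[X in measurable X]setTI; exact: measurable_tnth.
Qed.

Lemma measurable_tuple_boxes n : (measurable : set (set (n.-tuple T))) =
  <<s [set A | exists2 B : 'I_n -> set T,
                 forall i, measurable (B i) & A = box B] >>.
Proof.
apply/seteqP; split; last first.
  apply: smallest_sub; first exact: sigma_algebra_measurable.
  by move=> _ [B mB ->]; exact: measurable_box.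
apply: smallest_sub; first exact: smallest_sigma_algebra.
rewrite -bigcup_seq => A [i _ [B mB <-]]; apply: sub_sigma_algebra.
exists (fun j => if j == i then B else setT).
  by move=> j; case: ifP.
apply/seteqP; split => t /=.
  by move=> [_ Bt] j; case: ifPn => // /eqP ->.
by move=> /(_ i); rewrite eqxx.
Qed.

Lemma iid_law_unique (P : probability T R) n
    (Q : {measure set (n.-tuple T) -> \bar R}) :
  (forall B : 'I_n -> set T, (forall i, measurable (B i)) ->
    Q (box B) = (\prod_(i < n) P (B i))%E) ->
  forall A, measurable A -> Q A = iid_law P n A.
Proof.
move=> QB A mA.
apply: (measure_unique _ (fun=> setT) (@measurable_tuple_boxes n)) => //.
- move=> _ _ [B mB ->] [C mC ->]; exists (fun i => B i `&` C i).
    by move=> i; exact: measurableI.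
  apply/seteqP; split => t; first by move=> [Bt Ct] i; split.
  by move=> BCt; split => i; have [] := BCt i.
- by move=> _; exists (fun=> setT) => //; apply/seteqP; split.
- by apply/seteqP; split => // t _; exists 0%N.
- by move=> _ [B mB ->]; rewrite QB// -iid_law_box.
- move=> _; have -> : [set: n.-tuple T] = box (fun=> setT).
    by apply/seteqP; split.
  by rewrite QB// big1 ?ltry// => i _; rewrite probability_setT.
Qed.

Definition entries n m (u : m.-tuple 'I_n) (D : n.-tuple T) : m.-tuple T :=
  [tuple of map (tnth D) u].

Lemma measurable_entries n m (u : m.-tuple 'I_n) :
  measurable_fun setT (entries u).
Proof.
apply/measurable_fun_tnthP => i.
have -> : (@tnth m T)^~ i \o entries u = (@tnth n T)^~ (tnth u i).
  by apply/funext => D; rewrite /= tnth_map.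
exact: measurable_tnth.
Qed.

HB.instance Definition _ n m (u : m.-tuple 'I_n) :=
  isMeasurableFun.Build _ _ _ _ (entries u) (measurable_entries u).

(** This is exchangeability and consistency in one statement: permuting the
sample and passing to a subsample are both a selection of distinct entries. *)
Lemma iid_law_entries (P : probability T R) n m (u : m.-tuple 'I_n) A :
  uniq u -> measurable A -> iid_law P n (entries u @^-1` A) = iid_law P m A.
Proof.
move=> uu.
apply: (@iid_law_unique P m (distribution (iid_law P n) (entries u))).
move=> B mB.
(* The entries that are not selected are left unconstrained. *)
pose C j := if [pick i | tnth u i == j] is Some i then B i else setT.
have Cu i : C (tnth u i) = B i.
  rewrite /C; case: pickP => [i' /eqP/(tuple_uniqP _ uu) -> //|/(_ i)].
  by rewrite eqxx.
transitivity (iid_law P n (box C)).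
  congr (iid_law P n _); apply/seteqP; split => t /= Bt.
    move=> j; rewrite /C; case: pickP => // i /eqP <-.
    by have := Bt i; rewrite tnth_map.
  by move=> i; rewrite tnth_map -Cu; exact: Bt.
rewrite iid_law_box; last by move=> j; rewrite /C; case: pickP.
rewrite (bigID (mem u))/= [X in (_ * X)%E]big1 ?mule1; last first.
  move=> j ju; rewrite /C; case: pickP => [i /eqP uij|_].
    by rewrite -uij mem_tnth in ju.
  exact: probability_setT.
rewrite -(big_uniq _ uu)/= big_tuple.
by apply: eq_bigr => i _; rewrite Cu.
Qed.

Lemma integral_iid_law_entries (P : probability T R) n m (u : m.-tuple 'I_n)
    (f : m.-tuple T -> \bar R) :
  uniq u -> measurable_fun setT f -> (forall t, (0 <= f t)%E) ->
  (\int[iid_law P n]_D f (entries u D) = \int[iid_law P m]_D f D)%E.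
Proof.
move=> uu mf f0.
transitivity (\int[distribution (iid_law P n) (entries u)]_D f D)%E.
  by rewrite ge0_integral_distribution.
by apply: eq_measure_integral => A mA _; exact: iid_law_entries.
Qed.

Definition cat_pair n m (z : n.-tuple T * m.-tuple T) : (n + m).-tuple T :=
  [tuple of z.1 ++ z.2].

Lemma measurable_cat_pair n m : measurable_fun setT (@cat_pair n m).
Proof.
apply/measurable_fun_tnthP => i; case: (split_ordP i) => j ->.
- have -> : ((@tnth _ T)^~ (lshift m j)) \o @cat_pair n m =
      ((@tnth _ T)^~ j) \o fst.
    by apply/funext => -[s t]; rewrite /= tnth_lshift.
  by apply: measurableT_comp => //; exact: measurable_tnth.
- have -> : ((@tnth _ T)^~ (rshift n j)) \o @cat_pair n m =
      ((@tnth _ T)^~ j) \o snd.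
    by apply/funext => -[s t]; rewrite /= tnth_rshift.
  by apply: measurableT_comp => //; exact: measurable_tnth.
Qed.

HB.instance Definition _ n m :=
  isMeasurableFun.Build _ _ _ _ (@cat_pair n m) (@measurable_cat_pair n m).

Lemma iid_law_cat (P : probability T R) n m A : measurable A ->
  (iid_law P n \x iid_law P m)%E (@cat_pair n m @^-1` A) =
  iid_law P (n + m) A.
Proof.
apply: (@iid_law_unique P (n + m)
  (distribution (iid_law P n \x iid_law P m)%E (@cat_pair n m))) => B mB.
transitivity ((iid_law P n \x iid_law P m)%E
    (box (fun i => B (lshift m i)) `*` box (fun i => B (rshift n i)))).
  congr ((iid_law P n \x iid_law P m)%E _).
  apply/seteqP; split => -[s t] /=.
    move=> Bst; split => i.
      by have := Bst (lshift m i); rewrite tnth_lshift.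
    by have := Bst (rshift n i); rewrite tnth_rshift.
  by move=> [Bs Bt] i; case: (split_ordP i) => j ->;
    rewrite ?tnth_lshift ?tnth_rshift; [exact: Bs|exact: Bt].
rewrite product_measure1E; [|exact: measurable_box..].
by rewrite [RHS]big_split_ord/= -!iid_law_box.
Qed.

End iid_sample.

(** * Counting injections and ranks *)

Section counting.

(** Rearranging a sample by [u] puts the entries chosen by [f] last, in the
positions of the test points. *)
Lemma injection_completion n k (f : {ffun 'I_k -> 'I_(n + k)}) :
  injective f -> exists2 u : (n + k).-tuple 'I_(n + k),
    uniq u & forall j, tnth u (rshift n j) = f j.
Proof.
move=> f_inj; pose rest := enum [predC codom f].
have size_rest : size rest = n.
  have := cardC [in codom f]; rewrite card_codom// !card_ord -cardE => /eqP.
  by rewrite addnC eqn_add2r => /eqP.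
have size_u : size (rest ++ codom f) == (n + k)%N.
  by rewrite size_cat size_rest size_codom card_ord.
exists (Tuple size_u) => /=.
  rewrite cat_uniq enum_uniq/=; apply/andP; split.
    by apply/hasPn => i fi; rewrite mem_enum inE /= negbK.
  by rewrite map_inj_uniq ?enum_uniq.
move=> j; rewrite (tnth_nth (f j))/= nth_cat size_rest ltnNge leq_addr/=.
by rewrite addKn codomE (nth_map j) ?size_enum_ord // nth_ord_enum.
Qed.

Lemma expn_le_ffact n k : (n ^ k <= (n + k) ^_ k)%N.
Proof.
elim: k => [|k IH]; first by rewrite expn0 ffactn0.
by rewrite addnS ffactSS expnS leq_mul// ltnW// ltnS leq_addr.
Qed.

Lemma sum_injections_into (I T : finType) (G : {set T}) :
  (\sum_(f : {ffun I -> T} | injectiveb f) [forall i, f i \in G] <=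
   #|G| ^ #|I|)%N.
Proof.
rewrite -card_ffun_on -sum1_card [leqRHS]big_mkcond/= [leqLHS]big_mkcond/=.
by apply: leq_sum => f _; case: ifP.
Qed.

(** The lowest-scoring index of the set beats no member of the set, so what it
beats lies in the complement. *)
Lemma card_high_rank (R : realType) (I : finType) (S : I -> R) (c : R)
    (G : {set I}) : c <= #|I|%:R ->
  (forall i, i \in G -> c <= #|[pred l | S l < S i]|%:R) ->
  #|G|%:R <= #|I|%:R - c.
Proof.
move=> cI Gc; have [->|[i0 i0G]] := set_0Vmem G.
  by rewrite cards0 subr_ge0.
have [i iG imin] := arg_minP S i0G.
rewrite lerBrDr (le_trans (lerD (lexx _) (Gc i iG)))// -natrD ler_nat.
rewrite -(cardsC G) leq_add2l; apply: subset_leq_card.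
apply/fintype.subsetP => l.
by rewrite !inE ltNge; apply: contra => /imin.
Qed.

End counting.

(** * In-sample stability along a growing sample *)

Section stability.
Context d (X : measurableType d) (R : realType).
Variable A : algorithm X R.
Hypothesis symA : symmetric_algorithm A.

Lemma symmetric_perm_eq s1 s2 : perm_eq s1 s2 -> A s1 = A s2 :> (X -> R).
Proof.
move=> /(tuple_permP (t := in_tuple s2))[p ->].
by rewrite -(symA (in_tuple s2)).
Qed.

Variables (P : probability (X * R)%type R) (n0 : nat) (b : R).
Hypotheses (n0_gt0 : (0 < n0)%N) (stabA : stability_measurable A).
Hypothesis betaA : (beta_in_star A P n0 <= b%:E)%E.

Lemma stability_add1 N (e : seq 'I_N) (x i : 'I_N) :
  uniq (rcons e x) -> (n0 <= size e)%N -> i \in e ->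
  exists2 H, mean_le (iid_law P N) H b &
    forall D, `|A (map (tnth D) e) (tnth D i).1 -
                A (map (tnth D) (rcons e x)) (tnth D i).1| <= H D.
Proof.
rewrite rcons_uniq => /andP[xe eu] n0e ie.
have e_gt0 := leq_trans n0_gt0 n0e.
have ip : perm_eq (i :: rem i e) e by rewrite perm_sym perm_to_rem.
have size_u : size (i :: rcons (rem i e) x) == (size e).+1.
  by rewrite -rcons_cons size_rcons (perm_size ip).
(* The point of evaluation comes first and the added point last, which is where
   the definition of in-sample stability puts them. *)
pose u := Tuple size_u.
have uu : uniq u.
  by rewrite -[tval u]rcons_cons rcons_uniq (perm_mem ip) xe (perm_uniq ip).
have mu := stabA e_gt0.
exists (fun D => in_sample_change A (entries u D)).
  split.
  - exact: (measurableT_comp mu (measurable_entries u)).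
  - by move=> D; exact: normr_ge0.
  - rewrite (integral_iid_law_entries _
      (f := fun D => (in_sample_change A D)%:E))//; last 2 first.
    + exact/measurable_EFinP.
    + by move=> t; rewrite lee_fin normr_ge0.
    by apply: le_trans betaA; apply: ereal_sup_ubound; exists (size e).
move=> D; rewrite /in_sample_change.
have -> : thead (entries u D) = tnth D i.
  by rewrite /thead tnth_map (tnth_nth i).
have -> : take (size e) (entries u D) = map (tnth D) (i :: rem i e).
  rewrite -[tval (entries u D)]/(map _ (i :: rcons _ _)) -map_take -rcons_cons.
  by rewrite -(perm_size ip) -cats1 take_size_cat.
rewrite (symmetric_perm_eq (perm_map (tnth D) ip)).
rewrite (@symmetric_perm_eq (map (tnth D) (rcons e x)) (entries u D))//.
apply: perm_map; rewrite -[tval u]rcons_cons perm_sym.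
by rewrite -!cats1 perm_cat2r.
Qed.

(** The mean of each change is controlled at all sample sizes from [n0] on, so
the steps add up by the triangle inequality. *)
Lemma stability_add N (o e : seq 'I_N) (i : 'I_N) :
  uniq (e ++ o) -> (n0 <= size e)%N -> i \in e ->
  exists2 H, mean_le (iid_law P N) H ((size o)%:R * b) &
    forall D, `|A (map (tnth D) e) (tnth D i).1 -
                A (map (tnth D) (e ++ o)) (tnth D i).1| <= H D.
Proof.
elim: o e => [|x o IH] e.
  move=> _ _ _; exists (fun=> 0); first by rewrite mul0r; exact: mean_le0.
  by move=> D; rewrite cats0 subrr normr0.
rewrite -cat_rcons => ueo n0e ie.
have uex : uniq (rcons e x) by move: ueo; rewrite cat_uniq => /andP[].
have [H mean_H leH] := stability_add1 uex n0e ie.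
have [||K mean_K leK] := IH _ ueo.
- by rewrite size_rcons (leq_trans n0e).
- by rewrite mem_rcons inE ie orbT.
exists (fun D => H D + K D).
- by rewrite mulrS mulrDl mul1r; exact: mean_leD.
- move=> D; apply: le_trans (lerD (leH D) (leK D)).
  by rewrite (le_trans _ (ler_normD _ _))// addrA subrK.
Qed.

End stability.

(** * Miscovered points have a high score *)

Section scores.
Context d (X : measurableType d) (R : realType).

(** The infimum defining the quantile is undercut exactly when some admissible
threshold [t] is: one with at least [(1 - alpha) * n.+1] training scores, that
is [n] times the inflated level, at or below it. An infinite quantile means that
there is no such [t]. *)
Lemma miscovered_scoreP (A : algorithm X R) (alpha gamma : R) n
    (D : n.-tuple (X * R)) x y : (0 < n)%N ->
  let mu := A (rcons D (x, y)) in
  ~ cp_set A alpha gamma D x y <->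
  exists t, t + gamma < `|y - mu x| /\
    (1 - alpha) * n.+1%:R <=
      #|[pred i | `|(tnth D i).2 - mu (tnth D i).1| <= t]|%:R.
Proof.
move=> n_gt0 mu; rewrite /cp_set /= -/mu.
set scores := map _ D; set tau := _ * (1 + _).
have levelE : tau * (size scores)%:R = (1 - alpha) * n.+1%:R.
  rewrite size_map size_tuple /tau -mulrA; congr (_ * _).
  by rewrite mulrDl mul1r mulVf ?pnatr_eq0 -?lt0n// -natr1 addrC.
have countE t : count (fun r => r <= t) scores =
    #|[pred i | `|(tnth D i).2 - mu (tnth D i).1| <= t]|.
  by rewrite count_map -sum1_count big_tuple sum1_card.
transitivity (quantile scores tau < (`|y - mu x| - gamma)%:E)%E.
  by rewrite EFinB lteBrDr// ltNge; split => /negP.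
split=> [/ereal_inf_lt[_ [t /= le_count <-]]|[t [t_lt le_card]]].
  rewrite lte_fin ltrBrDr => t_lt; exists t; split => //.
  by rewrite -levelE -countE.
apply/ereal_inf_ltP; exists t%:E; last by rewrite lte_fin ltrBrDr.
by exists t => //=; rewrite levelE countE.
Qed.

(** Passing from the scores [r] to the scores [S], the test score loses less
than [gamma / 2] and training scores gain less than [gamma / 2], except where
[Delta] is large; the gap [gamma] between the level [t] and the test score
absorbs both.
The second alternative is a Markov bound in pointwise form: it holds as soon as
[Delta0] is large or at least [m] of the [Delta i] are. *)
Lemma rank_or_unstable (I : finType) (S r Delta : I -> R)
    (S0 r0 Delta0 t gamma c m : R) :
  0 < gamma -> 0 < m ->
  (forall i, `|r i - S i| <= Delta i) -> `|r0 - S0| <= Delta0 ->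
  t + gamma < r0 -> c <= #|[pred i | r i <= t]|%:R ->
  c - m <= #|[pred i | S i < S0]|%:R \/
  1 <= 2 / gamma * (Delta0 + m^-1 * \sum_i Delta i).
Proof.
move=> gamma_gt0 m_gt0 rS rS0 tr0 ct.
have Delta_ge0 i : 0 <= Delta i by exact: le_trans (rS i).
have Delta0_ge0 : 0 <= Delta0 by exact: le_trans rS0.
have sum_ge0 : 0 <= \sum_i Delta i by apply: sumr_ge0.
have half_le z : gamma / 2 <= z -> 1 <= 2 / gamma * z.
  move=> hz; have -> : 2 / gamma * z = z / (gamma / 2) by field; lra.
  by rewrite ler_pdivlMr ?mul1r// divr_gt0.
have [D0_ge|D0_lt] := leP (gamma / 2) Delta0.
  right; apply: half_le; rewrite (le_trans D0_ge)// lerDl mulr_ge0// invr_ge0.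
  exact: ltW.
pose B := [pred i | gamma / 2 <= Delta i].
have [mB|Bm] := leP m #|B|%:R.
  right; apply: half_le; rewrite -[leLHS]add0r lerD//.
  rewrite [leRHS]mulrC ler_pdivlMr//.
  apply: (@le_trans _ _ (\sum_(i in B) gamma / 2)).
    by rewrite sumr_const -[leRHS]mulr_natr ler_wpM2l// divr_ge0 1?ltW.
  rewrite [leRHS](bigID (mem B))/= -[leLHS]addr0 lerD//; last exact: sumr_ge0.
  by apply: ler_sum => i.
left; rewrite lerBlDr (le_trans ct)// (le_trans _ (lerD (lexx _) (ltW Bm)))//.
rewrite -natrD ler_nat -cardUI (leq_trans _ (leq_addr _ _))//.
apply: subset_leq_card; apply/fintype.subsetP => i; rewrite !inE => rit.
have [|Bi] := leP (gamma / 2) (Delta i); first by rewrite orbT.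
rewrite orbF; have := rS i; have := rS0.
rewrite !ler_norml => /andP[_ h0] /andP[h _]; lra.
Qed.

End scores.

(** * Missing many independent test points *)

Section test_block.
Context d (X : measurableType d) (R : realType).
Variables (A : algorithm X R) (P : probability (X * R)%type R).
Variables (alpha gamma : R) (n k : nat).
Hypothesis mcp : cp_measurable A alpha gamma n.

Definition missed (D : n.-tuple (X * R)) : set (X * R) :=
  [set z | ~ cp_set A alpha gamma D z.1 z.2].

Definition train_idx : n.-tuple 'I_(n + k) := [tuple lshift k i | i < n].

Definition all_missed : set ((n + k).-tuple (X * R)) :=
  [set D | forall j : 'I_k, missed (entries train_idx D) (tnth D (rshift n j))].

Lemma measurable_missed D : measurable (missed D).
Proof.
have := measurable_xsection D mcp; congr measurable.
by apply/seteqP; split => z; rewrite /xsection/= inE.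
Qed.

Lemma measurable_miscoverage :
  measurable_fun setT (miscoverage A P alpha gamma (n := n)).
Proof.
have := measurable_fun_xsection P mcp; congr measurable_fun.
apply/funext => D; rewrite /miscoverage /=; congr (P _).
by apply/seteqP; split => z; rewrite /xsection/= inE.
Qed.

Lemma measurable_all_missed : measurable all_missed.
Proof.
have -> : all_missed = \bigcap_(j in [set: 'I_k])
    ((fun D => (entries train_idx D, tnth D (rshift n j))) @^-1`
     [set w | missed w.1 w.2]).
  by apply/seteqP; split => D /= HD j; [move=> _|]; exact: HD.
apply: fin_bigcap_measurable => // j _; rewrite -[X in measurable X]setTI.
by apply: (measurable_fun_pair (measurable_entries _) (measurable_tnth _)).
Qed.

Lemma entries_train_cat (D : n.-tuple (X * R)) (E : k.-tuple (X * R)) :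
  entries train_idx (cat_pair (D, E)) = D.
Proof.
by apply: eq_from_tnth => i; rewrite tnth_map tnth_mktuple tnth_lshift.
Qed.

Lemma lee_exp_prod (c : R) (x : \bar R) m : 0 <= c -> (c%:E <= x)%E ->
  ((c ^+ m)%:E <= \prod_(i < m) x)%E.
Proof.
move=> c0 cx; elim: m => [|m IH]; first by rewrite expr0 big_ord0.
rewrite big_ord_recl exprS EFinM lee_pmul// lee_fin//.
exact: exprn_ge0.
Qed.

(** Given the training sample the test points are independent, so they are all
missed with conditional probability the [k]-th power of the miscoverage; this is
Markov's inequality for that power. *)
Lemma miscoverage_markov (c : R) : 0 <= c ->
  ((c ^+ k)%:E * iid_law P n [set D |
      (c%:E <= miscoverage A P alpha gamma D)%E] <=
   iid_law P (n + k) all_missed)%E.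
Proof.
move=> c0; set S := [set D | _]; set V := @cat_pair _ _ n k @^-1` all_missed.
have mS : measurable S.
  rewrite -[S]setTI; apply: emeasurable_fun_c_infty => //.
  exact: measurable_miscoverage.
have mV : measurable V.
  rewrite -[V]setTI; apply: measurable_cat_pair => //.
  exact: measurable_all_missed.
rewrite -iid_law_cat; last exact: measurable_all_missed.
rewrite -[S]setIT -integral_indic// -ge0_integralZl//; last 2 first.
- exact/measurable_EFinP.
- by rewrite lee_fin exprn_ge0.
apply: ge0_le_integral => //.
- by move=> D _; rewrite mule_ge0// lee_fin ?exprn_ge0.
- by apply: measurable_funeM; exact/measurable_EFinP.
- exact: measurable_fun_xsection.
move=> D _ /=; rewrite indicE; have [|_] := boolP (D \in S); last first.
  by rewrite mule0.
rewrite inE mule1 => SD.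
have -> : xsection V D = box (fun=> missed D).
  apply/seteqP; split => E; rewrite /xsection/= inE /V /= /all_missed /=
    entries_train_cat => HE j; first by have := HE j; rewrite tnth_rshift.
  by rewrite tnth_rshift; exact: HE.
rewrite [leRHS](iid_law_box P (B := fun=> missed D)) => [|_]; last first.
  exact: measurable_missed.
exact: lee_exp_prod.
Qed.

End test_block.

(** * Miscoverage of a whole block of test points *)

Section block_bound.
Context d (X : measurableType d) (R : realType).
Variables (A : algorithm X R) (P : probability (X * R)%type R).
Variables (alpha gamma delta b : R) (n k : nat).
Hypotheses (symA : symmetric_algorithm A) (stabA : stability_measurable A).
Hypotheses (mcp : cp_measurable A alpha gamma n) (n_gt0 : (0 < n)%N).
Hypothesis betaA : (beta_in_star A P n.+1 <= b%:E)%E.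
Hypotheses (b_ge0 : 0 <= b) (gamma_gt0 : 0 < gamma) (delta_gt0 : 0 < delta).
Hypotheses (alpha_gt0 : 0 < alpha) (alpha_lt1 : alpha < 1).

Let N := (n + k)%N.
Let t : R := (1 - alpha - delta) * n%:R.

Definition full_score (D : N.-tuple (X * R)) (l : 'I_N) : R :=
  `|(tnth D l).2 - A D (tnth D l).1|.

Definition high_rank (D : N.-tuple (X * R)) (l : 'I_N) : bool :=
  t <= #|[pred i | full_score D i < full_score D l]|%:R.

Lemma train_test_perm (j : 'I_k) :
  perm_eq (rcons (train_idx n k) (rshift n j) ++
             map (@rshift n k) (rem j (enum 'I_k)))
          (enum 'I_N).
Proof.
have -> : rcons (train_idx n k) (rshift n j) ++
    map (@rshift n k) (rem j (enum 'I_k)) =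
    train_idx n k ++ map (@rshift n k) (j :: rem j (enum 'I_k)).
  by rewrite cat_rcons.
apply: (@perm_trans _ (train_idx n k ++ map (@rshift n k) (enum 'I_k))).
  rewrite perm_cat2l perm_map// perm_sym perm_to_rem//.
  by rewrite mem_enum.
apply: uniq_perm; rewrite ?enum_uniq//.
  rewrite cat_uniq (map_inj_uniq (@lshift_inj n k)).
  rewrite (map_inj_uniq (@rshift_inj n k)).
  apply/and3P; split; [exact: enum_uniq| |exact: enum_uniq].
  apply/hasPn => _ /mapP[j' _ ->]; apply/mapP => -[i _].
  by move=> /eqP; rewrite eq_rlshift.
move=> l; rewrite mem_enum mem_cat.
by case: (split_ordP l) => i ->; apply/orP; [left|right];
  rewrite map_f// mem_enum.
Qed.

(** The refitted model has seen the training sample and the [j]-th test point;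
the full model has seen the other test points as well. Unless [H] is large, the
residuals of both models differ by less than [gamma / 2] at the test point and
at all but [delta * n] training points. *)
Lemma miscovered_high_rank (j : 'I_k) : exists2 H,
  mean_le (iid_law P N) H (2 / gamma * (k%:R * b * (1 + delta^-1))) &
  forall D, missed A alpha gamma (entries (train_idx n k) D)
      (tnth D (rshift n j)) ->
    high_rank D (rshift n j) \/ 1 <= H D.
Proof.
pose e := rcons (train_idx n k) (rshift n j).
pose o := map (@rshift n k) (rem j (enum 'I_k)).
have eo_perm : perm_eq (e ++ o) (enum 'I_N) := train_test_perm j.
have eo_uniq : uniq (e ++ o) by rewrite (perm_uniq eo_perm) enum_uniq.
have size_e : size e = n.+1 by rewrite size_rcons size_tuple.
have size_o : (size o)%:R * b <= k%:R * b.
  rewrite ler_wpM2r// ler_nat size_map size_rem ?mem_enum//.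
  by rewrite size_enum_ord leq_pred.
have change (i : 'I_N) : exists H, i \in e ->
    mean_le (iid_law P N) H (k%:R * b) /\
    forall D, `|A (map (tnth D) e) (tnth D i).1 - A D (tnth D i).1| <= H D.
  have [ie|_] := boolP (i \in e); last by exists (fun=> 0).
  have [|H mean_H leH] :=
    stability_add symA (ltn0Sn n) stabA betaA eo_uniq _ ie.
    by rewrite size_e.
  exists H => _; split; first exact: mean_leW mean_H.
  move=> D; have eoD : perm_eq (map (tnth D) (e ++ o)) D.
    by rewrite -[X in perm_eq _ X]map_tnth_enum perm_map.
  by rewrite -(symmetric_perm_eq symA eoD).
have [K KP] := choice change.
have train_e i : lshift k i \in e.
  by rewrite mem_rcons inE map_f ?orbT// mem_enum.
have test_e : rshift n j \in e by rewrite mem_rcons inE eqxx.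
exists (fun D => 2 / gamma * (K (rshift n j) D +
    (delta * n%:R)^-1 * \sum_(i < n) K (lshift k i) D)).
  apply: mean_leZ; first by rewrite divr_ge0// ltW.
  rewrite mulrDr mulr1; apply: mean_leD; first exact: (KP _ test_e).1.
  have -> : k%:R * b * delta^-1 =
      (delta * n%:R)^-1 * (#|'I_n|%:R * (k%:R * b)).
    by rewrite card_ord; field; rewrite !gt_eqF// ltr0n.
  apply: mean_leZ; first by rewrite invr_ge0 mulr_ge0// ltW.
  by apply: mean_le_sum => i _; exact: (KP _ (train_e i)).1.
move=> D; rewrite /missed /=.
move=> /(miscovered_scoreP A alpha gamma _ _ _ n_gt0)[s [s_lt le_card]].
have refitE : rcons (entries (train_idx n k) D)
    ((tnth D (rshift n j)).1, (tnth D (rshift n j)).2) = map (tnth D) e.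
  by rewrite map_rcons -surjective_pairing.
rewrite refitE in s_lt le_card.
pose refit_score l := `|(tnth D l).2 - A (map (tnth D) e) (tnth D l).1|.
have near l : l \in e -> `|refit_score l - full_score D l| <= K l D.
  move=> le; apply: le_trans ((KP _ le).2 D).
  rewrite /refit_score /full_score.
  apply: le_trans (ler_dist_dist _ _) _.
  by rewrite opprB [X in `|X|]addrC addrA subrK distrC.
have [|||||rank|] := @rank_or_unstable R 'I_n
  (full_score D \o lshift k) (refit_score \o lshift k)
  (fun i => K (lshift k i) D)
  (full_score D (rshift n j)) (refit_score (rshift n j)) (K (rshift n j) D)
  s gamma ((1 - alpha) * n%:R) (delta * n%:R) gamma_gt0.
- by rewrite mulr_gt0// ltr0n.
- by move=> i; exact: near.
- exact: near.
- exact: s_lt.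
- apply: le_trans (le_trans _ le_card) _.
    by rewrite ler_wpM2l ?ler_nat// subr_ge0 ltW.
  rewrite ler_nat; apply: subset_leq_card; apply/fintype.subsetP => i.
  by rewrite !inE tnth_map tnth_mktuple.
- left; rewrite /high_rank /t mulrBl (le_trans rank)// ler_nat.
  rewrite -(fintype.card_image (@lshift_inj n k)); apply: subset_leq_card.
  by apply/fintype.subsetP => _ /fintype.imageP[i + ->]; rewrite !inE.
- by right.
Qed.

Lemma full_score_entries (u : N.-tuple 'I_N) D l : uniq u ->
  full_score (entries u D) l = full_score D (tnth u l).
Proof.
move=> uu; rewrite /full_score tnth_map.
rewrite (symmetric_perm_eq symA (s1 := entries u D) (s2 := D))//.
rewrite -[X in perm_eq _ X]map_tnth_enum; apply/perm_map/uniq_perm => //.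
  exact: enum_uniq.
move=> i; rewrite mem_enum.
have /codomP[j ->] := injF_onto (tuple_uniqP _ uu) i.
exact: mem_tnth.
Qed.

(** Rearranging the sample leaves the fit unchanged and permutes the residuals,
so ranks follow the points. *)
Lemma high_rank_entries (u : N.-tuple 'I_N) D l : uniq u ->
  high_rank (entries u D) l = high_rank D (tnth u l).
Proof.
move=> uu; rewrite /high_rank; congr (_ <= _%:R).
rewrite -[RHS]sum1_card (reindex_inj (tuple_uniqP _ uu)) sum1_card/=.
by apply: eq_card => i; rewrite !inE !full_score_entries.
Qed.

Lemma all_missed_high_rank : exists2 H,
  mean_le (iid_law P N) H (k%:R * (2 / gamma * (k%:R * b * (1 + delta^-1)))) &
  forall D, all_missed A alpha gamma D ->
    (forall j, high_rank D (rshift n j)) \/ 1 <= H D.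
Proof.
have [K meanK KP] : exists2 K : 'I_k -> N.-tuple (X * R) -> R,
    forall j, mean_le (iid_law P N) (K j)
      (2 / gamma * (k%:R * b * (1 + delta^-1))) &
    forall j D, missed A alpha gamma (entries (train_idx n k) D)
      (tnth D (rshift n j)) -> high_rank D (rshift n j) \/ 1 <= K j D.
  have /choice[K KP] : forall j, exists K,
      mean_le (iid_law P N) K (2 / gamma * (k%:R * b * (1 + delta^-1))) /\
      forall D, missed A alpha gamma (entries (train_idx n k) D)
        (tnth D (rshift n j)) -> high_rank D (rshift n j) \/ 1 <= K D.
    by move=> j; have [K] := miscovered_high_rank j; exists K.
  by exists K => j; have [] := KP j.
exists (fun D => \sum_j K j D).
  by have := mean_le_sum (p := 'I_k) (fun j _ => meanK j); rewrite card_ord.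
move=> D missedD.
have [[j Kj]|noK] := pselect (exists j, 1 <= K j D); [right|left=> j].
  rewrite (le_trans Kj)// (bigD1 j)//= lerDl sumr_ge0// => i _.
  by have [_ + _] := meanK i; exact.
by have [//|Kj] := KP j D (missedD j); case: noK; exists j.
Qed.

(** Every realisation is compared with all its rearrangements that bring an
injectively chosen block of [k] points to the test positions: only blocks inside
the set of high ranks can be missed entirely, up to instability. Summing before
integrating matters, since high-rank events need not be measurable while missed
blocks are. *)
Lemma all_missed_bound : t <= N%:R ->
  (iid_law P N (all_missed A alpha gamma (n := n) (k := k)) <=
   ((alpha + delta + k%:R / n%:R) ^+ k +
    k%:R * (2 / gamma * (k%:R * b * (1 + delta^-1))))%:E)%E.
Proof.
move=> tN; have [H meanH HP] := all_missed_high_rank.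
set E := (X in iid_law P N X); set c := k%:R * _ in meanH *.
have mE : measurable E by exact: measurable_all_missed.
have completion (f : {ffun 'I_k -> 'I_N}) : exists v : N.-tuple 'I_N,
    injectiveb f -> uniq v /\ forall j, tnth v (rshift n j) = f j.
  have [/injectiveP/injection_completion[v vu vf]|_] := boolP (injectiveb f).
    by exists v.
  by exists (ord_tuple N).
have [u uP] := choice completion.
pose inj : pred {ffun 'I_k -> 'I_N} := fun f => injectiveb f.
have card_inj : #|inj| = (N ^_ k)%N.
  by have := card_inj_ffuns 'I_k 'I_N; rewrite !card_ord cardsE.
have tE : N%:R - t = (alpha + delta + k%:R / n%:R) * n%:R.
  by rewrite /t /N natrD; field; rewrite pnatr_eq0 -lt0n.
pose w := N%:R - t.
have w_ge0 : 0 <= w by rewrite subr_ge0.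
have pointwise D : \sum_(f | inj f) \1_E (entries (u f) D) <=
    w ^+ k + \sum_(f | inj f) H (entries (u f) D).
  apply: (@le_trans _ _ (\sum_(f | inj f)
      ([forall j, f j \in finset (high_rank D)]%:R + H (entries (u f) D)))).
    apply: ler_sum => f /uP[uu uf]; rewrite indicE.
    have H_ge0 : 0 <= H (entries (u f) D) by have [_ + _] := meanH; exact.
    have [|_] := boolP (_ \in E); last by rewrite addr_ge0.
    (* Missing the block of [f] puts its points in the high ranks, or costs one
       unit of instability. *)
    rewrite inE => /HP[high|H1]; last by rewrite (le_trans H1)// lerDr.
    rewrite (_ : [forall j, _] = true) ?lerDl//.
    by apply/forallP => j; rewrite inE -uf -high_rank_entries.
  rewrite big_split lerD2r -natr_sum.
  apply: (@le_trans _ _ (#|finset (high_rank D)| ^ k)%N%:R).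
    by rewrite ler_nat -[k in leqRHS]card_ord; exact: sum_injections_into.
  rewrite natrX lerXn2r// ?nnegrE//.
  have := @card_high_rank R _ (full_score D) t (finset (high_rank D)).
  by rewrite card_ord; apply => // l; rewrite inE.
have mean_rhs : mean_le (iid_law P N)
    (fun D => w ^+ k + \sum_(f | inj f) H (entries (u f) D))
    (w ^+ k + (N ^_ k)%:R * c).
  apply: mean_leD.
    split => //; first by move=> _; exact: exprn_ge0.
    by rewrite integral_cst// [X in (_ * X)%E]probability_setT mule1.
  rewrite -card_inj; apply: mean_le_sum => f /uP[uu _].
  have [mH H0 Hc] := meanH; split.
  - exact: (measurableT_comp mH (measurable_entries _)).
  - by move=> D; exact: H0.
  - rewrite (integral_iid_law_entries _ (f := fun D => (H D)%:E))//.
    exact/measurable_EFinP.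
have sum_le : ((N ^_ k)%:R%:E * iid_law P N E <=
    (w ^+ k + (N ^_ k)%:R * c)%:E)%E.
  have [m_rhs rhs0 rhs_le] := mean_rhs; apply: le_trans rhs_le.
  rewrite -card_inj.
  have mE1 : measurable_fun setT (fun D => (\1_E D : R)%:E).
    by apply/measurable_EFinP; exact: measurable_indic.
  have mEu f : measurable_fun setT (fun D => (\1_E (entries (u f) D) : R)%:E).
    exact: (measurableT_comp mE1 (measurable_entries (u f))).
  have -> : (#|inj|%:R%:E * iid_law P N E)%E =
     (\int[iid_law P N]_D (\sum_(f <- enum inj) (\1_E (entries (u f) D))%:E))%E.
    rewrite ge0_integral_sum//.
    rewrite big_enum/= (eq_bigr (fun=> (fine (iid_law P N E))%:E)) => [|f].
      rewrite sumEFin sumr_const -[in RHS]mulr_natl EFinM.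
      by rewrite fineK ?fin_num_measure.
    move=> /uP[uu _]; rewrite fineK ?fin_num_measure//.
    rewrite (integral_iid_law_entries _ (f := fun D => (\1_E D)%:E))//.
    by rewrite integral_indic// setIT.
  apply: ge0_le_integral => //.
  + by move=> D _; apply: sume_ge0 => f _; rewrite lee_fin.
  + by apply: emeasurable_sum => f.
  + exact/measurable_EFinP.
  + by move=> D _; rewrite sumEFin big_enum lee_fin; exact: pointwise.
have EN : iid_law P N E \is a fin_num by exact: fin_num_measure.
move: sum_le; rewrite -(fineK EN) -EFinM !lee_fin.
have nk_gt0 : 0 < n%:R ^+ k :> R by rewrite exprn_gt0// ltr0n.
have nk_le : n%:R ^+ k <= (N ^_ k)%:R :> R.
  by rewrite -natrX ler_nat expn_le_ffact.
have M_gt0 := lt_le_trans nk_gt0 nk_le.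
rewrite mulrC -ler_pdivlMr// mulrDl mulrAC divff ?gt_eqF// mul1r => /le_trans.
apply; rewrite lerD2r /w tE exprMn ler_pdivrMr// ler_wpM2l//.
rewrite exprn_ge0//.
by rewrite !addr_ge0 ?divr_ge0// ltW.
Qed.

End block_bound.

(** * Letting the sample size tend to infinity *)

Section limits.
Context (R : realType).

Section tail.
Context d (X : measurableType d).

(** The factor multiplying [b / gamma] depends on [alpha], [eta] and [k] only,
so that [k] can be fixed before [n] grows. *)
Lemma miscoverage_tail (A : algorithm X R) (P : probability (X * R)%type R)
    (alpha gamma eta b : R) (n k : nat) :
  symmetric_algorithm A -> stability_measurable A ->
  cp_measurable A alpha gamma n -> (0 < n)%N ->
  (beta_in_star A P n.+1 <= b%:E)%E -> 0 <= b -> 0 < gamma -> 0 < eta ->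
  0 < alpha -> alpha < 1 -> k%:R / n%:R <= eta ->
  (iid_law P n [set D | ((alpha + 3 * eta)%:E <=
      miscoverage A P alpha gamma D)%E] <=
   (((alpha + 2 * eta) / (alpha + 3 * eta)) ^+ k +
    2 * k%:R ^+ 2 * (1 + eta^-1) / (alpha + 3 * eta) ^+ k * (b / gamma))%:E)%E.
Proof.
move=> symA stabA mcp n_gt0 betaA b_ge0 gamma_gt0 eta_gt0.
move=> alpha_gt0 alpha_lt1 kn.
have tN : (1 - alpha - eta) * n%:R <= (n + k)%:R.
  apply: (@le_trans _ _ (1 * n%:R)); first by rewrite ler_wpM2r//; lra.
  by rewrite mul1r ler_nat leq_addr.
have level_gt0 : 0 < alpha + 3 * eta by lra.
have levelk_gt0 : 0 < (alpha + 3 * eta) ^+ k by rewrite exprn_gt0.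
set p := (X in (X <= _)%E).
have := miscoverage_markov P k mcp (ltW level_gt0).
move=> /le_trans/(_ (all_missed_bound symA stabA mcp n_gt0 betaA b_ge0 gamma_gt0
  eta_gt0 alpha_gt0 alpha_lt1 tN)).
rewrite -/p.
have pfin : p \is a fin_num.
  apply: fin_num_measure; rewrite -[X in measurable X]setTI.
  by apply: emeasurable_fun_c_infty => //; exact: measurable_miscoverage.
rewrite -(fineK pfin) -EFinM !lee_fin mulrC -ler_pdivlMr// => /le_trans; apply.
rewrite mulrDl expr_div_n lerD//.
  apply: ler_wpM2r; first by rewrite invr_ge0 ltW.
  apply: lerXn2r; rewrite ?nnegrE.
  - by rewrite !addr_ge0 ?divr_ge0// ltW.
  - lra.
  - lra.
rewrite le_eqVlt; apply/orP; left; apply/eqP; field.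
by rewrite !gt_eqF.
Qed.

End tail.

(** If the bound for [m.+1%:R^-1] is valid from the index [n0 m] on, use at [n]
the largest [m < n] with [n0 m <= n]. *)
Lemma diagonal_rate (Q : nat -> R -> \bar R) :
  (forall e, 0 < e -> \forall n \near \oo, (Q n e <= e%:E)%E) ->
  exists2 eps : nat -> R, eps n @[n --> \oo] --> (0 : R) &
    \forall n \near \oo, (Q n (eps n) <= (eps n)%:E)%E.
Proof.
move=> Qe.
have start (m : nat) : exists n0, forall n, (n0 <= n)%N ->
    (Q n (m.+1%:R^-1)%R <= (m.+1%:R^-1)%:E)%E.
  by have [n0 _ h] := Qe m.+1%:R^-1 ltac:(by rewrite invr_gt0); exists n0.
have [n0 n0P] := choice start.
pose m n := (\max_(i < n | (n0 i <= n)%N) i)%N.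
exists (fun n => (m n).+1%:R^-1).
  apply/cvgr0Pnorm_le => e e_gt0.
  have [M _ /(_ M (leqnn _)) Me] := near_infty_natSinv_lt (PosNum e_gt0).
  exists (maxn M.+1 (n0 M)) => // n; rewrite /= geq_max => /andP[Mn n0n].
  rewrite ger0_norm ?invr_ge0// (le_trans _ (ltW Me))//.
  rewrite lef_pV2 ?posrE// ler_nat ltnS.
  exact: (@leq_bigmax_cond _ (fun i : 'I_n => (n0 i <= n)%N)
    (fun i => nat_of_ord i) (Ordinal Mn)).
exists (maxn 1 (n0 0%N)) => // n; rewrite /= geq_max => /andP[n_gt0 n0n].
apply: n0P; rewrite /m.
have [|i + ->//] := @eq_bigmax_cond _ [pred i : 'I_n | (n0 i <= n)%N]
  (fun i => nat_of_ord i).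
by apply/card_gt0P; exists (Ordinal n_gt0).
Qed.

End limits.

(** * An admissible algorithm *)

Section zero_algorithm.
Context d (X : measurableType d) (R : realType).

(** The supremum of the empty set is [-oo], so convergence to zero also requires
that some algorithm and distribution meet the constraints; this one meets them
for every distribution. *)
Definition zero_algorithm : algorithm X R := fun=> cst 0.

Lemma zero_symmetric : symmetric_algorithm zero_algorithm.
Proof. by []. Qed.

Lemma zero_in_sample_change n (D : n.+1.-tuple (X * R)) :
  in_sample_change zero_algorithm D = 0.
Proof. by rewrite /in_sample_change /= subrr normr0. Qed.

Lemma zero_stability_measurable : stability_measurable zero_algorithm.
Proof.
move=> n _; rewrite (_ : in_sample_change _ (n := n) = cst 0)//.
by apply/funext => D; exact: zero_in_sample_change.
Qed.

Lemma zero_beta_in_star P n : (beta_in_star zero_algorithm P n <= 0)%E.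
Proof.
apply: ge_ereal_sup => _ [m _ <-]; rewrite /beta_in.
by under eq_integral do rewrite zero_in_sample_change; rewrite integral0.
Qed.

(** The real threshold provided by the quantile ranges over an uncountable set;
recording which training scores lie below it makes the union finite. *)
Lemma zero_cp_measurable alpha gamma n : (0 < n)%N ->
  cp_measurable zero_algorithm alpha gamma n.
Proof.
move=> n_gt0.
pose below l := [set w : n.-tuple (X * R) * (X * R) |
  `|(tnth w.1 l).2| + gamma < `|w.2.2|].
have mbelow l : measurable (below l).
  rewrite -[below l]setTI; apply: measurable_fun_ltr => //.
    apply: measurable_funD => //; apply: measurableT_comp => //.
    apply: (measurableT_comp (f := snd)) => //.
    exact: (measurableT_comp (measurable_tnth l) measurable_fst).
  apply: measurableT_comp => //.
  exact: (measurableT_comp measurable_snd measurable_snd).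
rewrite /cp_measurable (_ : [set w | _] =
    \bigcup_(L in [set L : {set 'I_n} | (1 - alpha) * n.+1%:R <= #|L|%:R])
      \bigcap_(l in [set l | l \in L]) below l).
  apply: fin_bigcup_measurable => // L _.
  exact: fin_bigcap_measurable.
apply/seteqP; split => -[D [x y]] /=.
  move=> /(miscovered_scoreP _ _ _ _ _ _ n_gt0)[t [t_lt le_card]].
  exists (finset [pred i | `|(tnth D i).2| <= t]) => /=.
    apply: le_trans le_card _; rewrite ler_nat; apply: subset_leq_card.
    by apply/fintype.subsetP => l; rewrite !inE /= subr0.
  move=> l; rewrite /= inE /= => lt; rewrite /below /=.
  by move: t_lt; rewrite subr0; apply: le_lt_trans; rewrite lerD2r.
move=> [L /= cL Lbelow]; apply/(miscovered_scoreP _ _ _ _ _ _ n_gt0).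
(* The default value provides a threshold for an empty [L]; it lies below
   [`|y| - gamma], so it is harmless in general. *)
exists (\big[Num.max/`|y| - gamma - 1]_(l in L) `|(tnth D l).2|); split.
  rewrite subr0 -ltrBrDr; apply/bigmax_ltP; split; first lra.
  by move=> l /Lbelow; rewrite /below /= ltrBrDr.
apply: (le_trans cL); rewrite ler_nat; apply: subset_leq_card.
apply/fintype.subsetP => l lL; rewrite inE /= subr0.
exact: le_bigmax_cond.
Qed.

End zero_algorithm.

Theorem theorem3p7 (R : realType) (d : measure_display) (X : measurableType d)
    (alpha : R) (alpha_gt0 : 0 < alpha) (alpha_lt1 : alpha < 1)
    (b gamma : nat -> R)
    (b_gt0 : forall n, 0 < b n) (gamma_gt0 : forall n, 0 < gamma n)
    (b_gamma : b n / gamma n @[n --> \oo] --> (0 : R)) :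
  exists eps : nat -> R,
    eps n @[n --> \oo] --> (0 : R) /\
    ereal_sup [set p : \bar R |
      exists (A : algorithm X R) (P : probability (X * R)%type R),
        [/\ symmetric_algorithm A,
            stability_measurable A /\ cp_measurable A alpha (gamma n) n,
            (beta_in_star A P n.+1 <= (b n)%:E)%E
          & p = iid_law P n [set D : n.-tuple (X * R) |
                  ((alpha + eps n)%:E <= miscoverage A P alpha (gamma n) D)%E]]]
      @[n --> \oo] --> (0%E : \bar R).
Proof.
pose Q n e := ereal_sup [set p : \bar R |
  exists (A : algorithm X R) (P : probability (X * R)%type R),
    [/\ symmetric_algorithm A,
        stability_measurable A /\ cp_measurable A alpha (gamma n) n,
        (beta_in_star A P n.+1 <= (b n)%:E)%E
      & p = iid_law P n [set D : n.-tuple (X * R) |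
              ((alpha + e)%:E <= miscoverage A P alpha (gamma n) D)%E]]].
have Q_ge0 n e : (0 < n)%N -> (0 <= Q n e)%E.
  move=> n_gt0; pose P : probability (X * R)%type R :=
    \d_ (point : (X * R)%type).
  apply: le_trans (measure_ge0 (iid_law P n) _) (ereal_sup_ubound _).
  exists (@zero_algorithm _ X R), P; split.
  - exact: zero_symmetric.
  - by split; [exact: zero_stability_measurable|exact: zero_cp_measurable].
  - by apply: le_trans (zero_beta_in_star _ _) _; rewrite lee_fin ltW.
  - by [].
have Q_small e : 0 < e -> \forall n \near \oo, (Q n e <= e%:E)%E.
  move=> e_gt0; pose eta := e / 3.
  have eta_gt0 : 0 < eta by rewrite divr_gt0.
  have eE : e = 3 * eta by rewrite /eta; field.
  pose rho := (alpha + 2 * eta) / (alpha + 3 * eta).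
  have level_gt0 : 0 < alpha + 3 * eta by lra.
  have rho_ge0 : 0 <= rho by rewrite divr_ge0 ?ltW//; lra.
  have rho_lt1 : rho < 1 by rewrite ltr_pdivrMr// mul1r; lra.
  have [k rhok] : exists k, rho ^+ k <= eta.
    have /cvgr0Pnorm_le/(_ _ eta_gt0)[k _ /(_ k (leqnn _))] :
        (rho ^+ k @[k --> \oo] --> (0 : R)).
      by apply: cvg_expr; rewrite ger0_norm.
    by rewrite ger0_norm ?exprn_ge0// => ?; exists k.
  pose C := 2 * k%:R ^+ 2 * (1 + eta^-1) / (alpha + 3 * eta) ^+ k.
  have C_to0 : C * (b n / gamma n) @[n --> \oo] --> (0 : R).
    by rewrite -(mulr0 C); exact: cvgMr.
  near=> n.
  have n_gt0 : (0 < n)%N by near: n; exists 1%N.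
  have kn : k%:R / n%:R <= eta.
    rewrite ler_pdivrMr ?ltr0n// mulrC -ler_pdivrMr//.
    by near: n; exact: nbhs_infty_ger.
  have Cn : C * (b n / gamma n) <= eta.
    rewrite (le_trans (ler_norm _))//; near: n.
    by move/cvgr0Pnorm_le: C_to0; apply.
  apply: ge_ereal_sup => _ [A [P [symA [stabA mcp] betaA ->]]].
  rewrite eE; apply: le_trans (miscoverage_tail symA stabA mcp n_gt0 betaA
    (ltW (b_gt0 n)) (gamma_gt0 n) eta_gt0 alpha_gt0 alpha_lt1 kn) _.
  by rewrite lee_fin -/rho -/C; lra.
have [eps eps0 Qeps] := diagonal_rate Q_small.
exists eps; split => //.
apply: (@squeeze_cvge _ _ _ _ (cst 0%E) _ (fun n => (eps n)%:E)).
- near=> n; apply/andP; split; last by near: n.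
  by apply: Q_ge0; near: n; exists 1%N.
- exact: cvg_cst.
- by apply/cvg_EFin; [near=> n|].
Unshelve. all: by end_near.
Qed.
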